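(* Let $m \geq 2$ be an integer. Then $\alpha\left(F_{m,1}^{(2)}\right)=\left\lfloor \frac{m^{2}}{4}\right\rfloor$.
   Context: Graphs are finite and simple. For a graph $G$, the double vertex graph $G^{(2)}$ is the graph whose vertices are all $2$-subsets of $V(G)$, where two $2$-subsets are adjacent whenever their symmetric difference is (the set of endpoints of) an edge of $G$. The fan graph $F_{m,1}$ is the join $P_m+K_1$, where $P_m$ is the path graph with $m$ vertices and $K_1$ is the complete graph with one vertex (the join of two disjoint graphs adds all edges between them). $\alpha(G)$ denotes the independence number of $G$, i.e. the maximum cardinality of a set of pairwise non-adjacent vertices. *)

(* Defs.v *)
From mathcomp Require Import all_boot.
Set Implicit Arguments.
Unset Strict Implicit.
Unset Printing Implicit Defensive.

Record sgraph := SGraph {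
  vertex :> finType;
  adj : rel vertex;
  adj_sym : symmetric adj;
  adj_irrefl : irreflexive adj
}.

Definition path_adj (m : nat) : rel 'I_m :=
  fun i j => (i.+1 == j :> nat) || (j.+1 == i :> nat).

Lemma path_adj_sym (m : nat) : symmetric (@path_adj m).
Proof. by move=> i j; rewrite /path_adj orbC. Qed.

Lemma path_adj_irrefl (m : nat) : irreflexive (@path_adj m).
Proof. by move=> i; rewrite /path_adj orbb gtn_eqF. Qed.

Definition path_graph (m : nat) : sgraph :=
  SGraph (@path_adj_sym m) (@path_adj_irrefl m).

Definition complete_adj (n : nat) : rel 'I_n := fun i j => i != j.

Lemma complete_adj_sym (n : nat) : symmetric (@complete_adj n).
Proof. by move=> i j; rewrite /complete_adj eq_sym. Qed.

Lemma complete_adj_irrefl (n : nat) : irreflexive (@complete_adj n).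
Proof. by move=> i; rewrite /complete_adj eqxx. Qed.

Definition complete_graph (n : nat) : sgraph :=
  SGraph (@complete_adj_sym n) (@complete_adj_irrefl n).

Definition join_adj (G H : sgraph) : rel (G + H)%type :=
  fun u v => match u, v with
    | inl x, inl y => adj x y
    | inr x, inr y => adj x y
    | _, _ => true
    end.

Lemma join_adj_sym (G H : sgraph) : symmetric (@join_adj G H).
Proof. by move=> [x|x] [y|y] //=; apply: adj_sym. Qed.

Lemma join_adj_irrefl (G H : sgraph) : irreflexive (@join_adj G H).
Proof. by move=> [x|x] /=; apply: adj_irrefl. Qed.

Definition join_graph (G H : sgraph) : sgraph :=
  SGraph (@join_adj_sym G H) (@join_adj_irrefl G H).

(* F_{m,1} = P_m + K_1 *)
Definition fan1 (m : nat) : sgraph :=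
  join_graph (path_graph m) (complete_graph 1).

Definition symdiff (T : finType) (A B : {set T}) : {set T} :=
  (A :\: B) :|: (B :\: A).

Definition pairs (T : finType) := {A : {set T} | #|A| == 2}.

Definition double_vertex_adj (G : sgraph) : rel (pairs G) :=
  fun A B => [exists x : G, exists y : G,
    adj x y && (symdiff (val A) (val B) == [set x; y])].

Lemma double_vertex_adj_sym (G : sgraph) : symmetric (@double_vertex_adj G).
Proof. by move=> A B; rewrite /double_vertex_adj /symdiff setUC. Qed.

Lemma double_vertex_adj_irrefl (G : sgraph) :
  irreflexive (@double_vertex_adj G).
Proof.
move=> A; apply/negbTE/existsP => -[x /existsP[y /andP[_ /eqP]]].
by rewrite /symdiff setDv setU0 => /setP/(_ x); rewrite !inE eqxx.
Qed.

Definition double_vertex_graph (G : sgraph) : sgraph :=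
  SGraph (@double_vertex_adj_sym G) (@double_vertex_adj_irrefl G).

Definition independent (G : sgraph) (S : {set G}) : bool :=
  [forall x in S, forall y in S, (x != y) ==> ~~ adj x y].

Definition independence_number (G : sgraph) : nat :=
  \max_(S : {set G} | independent S) #|S|.

(* Main.v *)
Require Import Defs.
From mathcomp Require Import all_boot.
From mathcomp Require Import zify.

Set Implicit Arguments.
Unset Strict Implicit.
Unset Printing Implicit Defensive.

(** Upper bound: number the path vertices [0, ..., m-1] and let [c] be the apex.
Grouping the pairs [{k, u}] with [u < k] or [u = c] by [k^2/4 + floor(u/2)]
(reading [c] as [0]) partitions the double vertex graph into cliques: for [k >= 2]
these are the copies at [k] of the cliques [{0, 1, c}, {2, 3}, ...] of the fan on
[k] path vertices, and the pairs inside [{0, 1, c}] form the clique number [0].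
Since [k^2/4 + ceil(k/2) = (k+1)^2/4], exactly [m^2/4] numbers occur.  Lower bound:
the pairs made of one odd and one even path vertex are independent. *)

(** * Independence numbers and adjacency in double vertex graphs *)

Lemma leq_independence_number (G : sgraph) (S : {set G}) :
  independent S -> #|S| <= independence_number G.
Proof.
by move=> indS; rewrite /independence_number (bigmax_sup S).
Qed.

(** The fibres of [f] are cliques, so [f] is injective on an independent set. *)
Lemma independence_number_clique_cover (G : sgraph) (n : nat) (f : G -> nat) :
  (forall x, f x < n) ->
  (forall x y, x != y -> f x = f y -> adj x y) ->
  independence_number G <= n.
Proof.
move=> fn f_adj; apply/bigmax_leqP => S /forall_inP indS.
pose g x := Ordinal (fn x).
have g_inj : {in S &, injective g}.
  move=> x y xS yS /(congr1 val) /= fxy; apply/eqP/negP => /negP neq_xy.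
  have /forall_inP/(_ y yS) := indS x xS.
  by rewrite neq_xy f_adj.
by rewrite -(card_in_imset g_inj) -[n in _ <= n]card_ord max_card.
Qed.

Lemma double_vertex_adj_in_symdiff (G : sgraph) (A B : double_vertex_graph G)
    (u v : G) :
  adj A B -> u \in symdiff (val A) (val B) -> v \in symdiff (val A) (val B) ->
  u != v -> adj u v.
Proof.
move=> /existsP[x /existsP[y /andP[xy /eqP ->]]].
rewrite !inE => /orP[] /eqP -> /orP[] /eqP ->; rewrite ?eqxx // => _.
by rewrite adj_sym.
Qed.

Lemma double_vertex_adjI (G : sgraph) (A B : double_vertex_graph G) (x u v : G) :
  val A = [set x; u] -> val B = [set x; v] -> adj u v -> adj A B.
Proof.
move=> defA defB uv; apply/existsP; exists u; apply/existsP; exists v.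
rewrite uv /=; apply/eqP/setP => z; rewrite /symdiff defA defB !inE.
have neq_xu : x != u.
  by have := valP A; rewrite /= defA cards2; case: (x != u).
have neq_xv : x != v.
  by have := valP B; rewrite /= defB cards2; case: (x != v).
have neq_uv : u != v by apply/eqP => euv; move: uv; rewrite euv adj_irrefl.
have [->|_] := eqVneq z x; first by rewrite (negPf neq_xu) (negPf neq_xv).
have [->|_] := eqVneq z u; first by rewrite (negPf neq_uv).
by case: (z == v).
Qed.

(** * Quarter squares *)

Lemma sqr_div4 (n : nat) : n ^ 2 %/ 4 = n./2 * uphalf n.
Proof.
have [q [b ->]] : exists q, exists b : bool, n = q.*2 + b.
  by exists n./2, (odd n); rewrite addnC odd_double_half.
by case: b; rewrite ?addn0 ?addn1 /= ?uphalf_double ?doubleK; nia.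
Qed.

Lemma sqrS_div4 (n : nat) : n.+1 ^ 2 %/ 4 = n ^ 2 %/ 4 + uphalf n.
Proof. by rewrite !sqr_div4 /= uphalfE /= mulnS mulnC addnC. Qed.

(** Keeps the codes belonging to different [k > 0] apart: those of [k] fill [uphalf k] consecutive
    numbers from [k ^ 2 %/ 4] on. *)
Lemma leq_sqr_div4 (k l : nat) : k < l -> k ^ 2 %/ 4 + uphalf k <= l ^ 2 %/ 4.
Proof. by move=> ltkl; rewrite -sqrS_div4 leq_div2r // leq_exp2r. Qed.

(** * Upper bound: the clique cover *)

Section Fan.

Variable m : nat.

Local Notation apex := (inr ord0 : fan1 m).
Local Notation pv i := (inl i : fan1 m).

Definition fan_val (x : fan1 m) : nat := if x is inl i then i : nat else 0.

(** Maximum and sum are symmetric, so the code of a pair needs no choice of order: [k] is the larger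
    value and the sum minus [k] the other one. *)
Definition pair_code (A : {set fan1 m}) : nat :=
  let k := \max_(x in A) fan_val x in
  k ^ 2 %/ 4 + (\sum_(x in A) fan_val x - k)./2.

Lemma pair_codeE (k : 'I_m) (u : fan1 m) :
  pv k != u -> fan_val u <= k ->
  pair_code [set pv k; u] = k ^ 2 %/ 4 + (fan_val u)./2.
Proof.
move=> neq leuk; rewrite /pair_code !big_setU1 ?inE // !big_set1 /=.
by rewrite (maxn_idPl leuk) addKn.
Qed.

Variant pair_spec (A : {set fan1 m}) : Prop :=
  PairSpec (k : 'I_m) (u : fan1 m) of A = [set pv k; u]
    & (u == apex) || (fan_val u < k)
    & pair_code A = k ^ 2 %/ 4 + (fan_val u)./2.

Lemma pairP (A : double_vertex_graph (fan1 m)) : pair_spec (val A).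
Proof.
have spec (k : 'I_m) u : (u == apex) || (fan_val u < k) ->
    pair_spec [set pv k; u].
  move=> small; apply: (PairSpec erefl small); apply: pair_codeE.
    by apply/eqP => eku; move: small; rewrite -eku /= ltnn.
  by case/orP: small => [/eqP -> //|/ltnW].
have /cards2P[x [y [neq ->]]] := valP A.
case: x y neq => [i|i] [j|j] neq; try by rewrite ?(ord1 i) ?(ord1 j); apply: spec.
- case: (ltngtP i j) => [ltij|ltji|eqij].
  + by rewrite setUC; apply: spec; rewrite ltij orbT.
  + by apply: spec; rewrite ltji orbT.
  + by rewrite (val_inj eqij) eqxx in neq.
- by rewrite setUC (ord1 i); apply: spec.
- by rewrite (ord1 i) (ord1 j) eqxx in neq.
Qed.

Lemma pair_code_bound (A : double_vertex_graph (fan1 m)) :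
  2 <= m -> pair_code (val A) < m ^ 2 %/ 4.
Proof.
move=> hm; case: (pairP A) => k u _ small ->.
have := leq_sqr_div4 (ltn_ord k).
(* For [k = 0] the previous bound is not strict, as [uphalf 0 = 0]; here [hm] gives
   [1 <= m ^ 2 %/ 4]. *)
have := leq_sqr_div4 hm.
rewrite -[1 ^ 2 %/ 4 + uphalf 1]/1.
by case: u small => [i|i] /= small; have := ltn_ord k; case: (posnP k) => k0; lia.
Qed.

Lemma pair_code_adj (A B : double_vertex_graph (fan1 m)) :
  A != B -> pair_code (val A) = pair_code (val B) -> adj A B.
Proof.
case: (pairP A) (pairP B) => k u defA smallA -> [l w defB smallB ->].
wlog lekl : A B k l u w defA defB smallA smallB / k <= l => [IH|].
  case: (leqP k l) => [|/ltnW] lekl; first exact: IH.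
  by rewrite eq_sym adj_sym => neq /esym; apply: IH neq.
move=> neqAB eq_code; move: lekl; rewrite leq_eqVlt => /orP[/eqP/val_inj eqkl|ltkl].
  subst l; apply: (double_vertex_adjI defA defB).
  have nequw : u != w.
    by apply: contraNneq neqAB => equw; apply/eqP/val_inj; rewrite defA defB equw.
  (* Distinct path vertices with equal halves are consecutive; the apex is adjacent to every path
     vertex. *)
  case: u w nequw eq_code {defA defB smallA smallB} => [i|i] [j|j] //=.
  move=> neqij eq_half; rewrite /path_adj.
  have : (i : nat) <> j by move=> /val_inj eqij; rewrite eqij eqxx in neqij.
  by lia.
have ltgkl := leq_sqr_div4 ltkl.
(* If [k > 0], the code of [A] is below [k ^ 2 %/ 4 + uphalf k], hence below that of [B]. *)
have k0 : k = 0 :> nat.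
  by case: (posnP k) => // k0; case: u smallA eq_code {defA} => [i|i] /= smallA; lia.
have {}smallA : u = apex by case/orP: smallA => [/eqP //|]; rewrite k0.
have l1 : l = 1 :> nat.
  have [// |gt1l|l0] := ltngtP l 1; last by [].
    by lia.
  have := leq_sqr_div4 gt1l; rewrite -[1 ^ 2 %/ 4 + uphalf 1]/1.
  by move: eq_code; rewrite smallA k0 /=; lia.
(* Inside the triangle [{0, 1, c}]: [A] is [{0, c}], and [B] is [{1, 0}] or [{1, c}], sharing [0] or
   [c] with [A]. *)
subst u; case: w smallB defB {eq_code} => [j|j] smallB defB.
  have eqjk : j = k by apply: val_inj; move: smallB; rewrite /= k0 l1 ltnS leqn0 => /eqP.
  subst j; apply: (@double_vertex_adjI _ A B (pv k) apex (pv l)) => //.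
  by rewrite defB setUC.
rewrite (ord1 j) in defB.
apply: (@double_vertex_adjI _ _ _ apex (pv k) (pv l)).
- by rewrite defA setUC.
- by rewrite defB setUC.
- by rewrite /= /path_adj k0 l1.
Qed.

(** * Lower bound: pairs of mixed parity *)

Lemma odd_index_lt (a : 'I_m./2) : a.*2.+1 < m.
Proof. by have := ltn_ord a; lia. Qed.

Lemma even_index_lt (b : 'I_(uphalf m)) : b.*2 < m.
Proof. by have := ltn_ord b; lia. Qed.

Definition odd_vertex (a : 'I_m./2) : fan1 m := inl (Ordinal (odd_index_lt a)).
Definition even_vertex (b : 'I_(uphalf m)) : fan1 m :=
  inl (Ordinal (even_index_lt b)).

Lemma odd_vertex_eq a a' : (odd_vertex a == odd_vertex a') = (a == a').
Proof.
apply/eqP/eqP => [[eqa]|-> //]; apply: val_inj => /=; lia.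
Qed.

Lemma even_vertex_eq b b' : (even_vertex b == even_vertex b') = (b == b').
Proof.
apply/eqP/eqP => [[eqb]|-> //]; apply: val_inj => /=; lia.
Qed.

Lemma odd_even_vertex a b : (odd_vertex a == even_vertex b) = false.
Proof. by apply/eqP => -[]; lia. Qed.

Lemma mixed_pair_card (p : 'I_m./2 * 'I_(uphalf m)) :
  #|[set odd_vertex p.1; even_vertex p.2]| == 2.
Proof. by rewrite cards2 odd_even_vertex. Qed.

Definition mixed_pair (p : 'I_m./2 * 'I_(uphalf m)) :
    double_vertex_graph (fan1 m) :=
  exist _ [set odd_vertex p.1; even_vertex p.2] (mixed_pair_card p).

Lemma odd_vertex_in_mixed a p : (odd_vertex a \in val (mixed_pair p)) = (a == p.1).
Proof. by rewrite !inE odd_vertex_eq odd_even_vertex orbF. Qed.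

Lemma even_vertex_in_mixed b p :
  (even_vertex b \in val (mixed_pair p)) = (b == p.2).
Proof. by rewrite !inE even_vertex_eq eq_sym odd_even_vertex. Qed.

(** Both coordinates can be read off from the odd and the even member of the pair. *)
Lemma mixed_pair_inj : injective mixed_pair.
Proof.
move=> p q eqpq; apply/eqP; rewrite -pair_eqE /=.
by rewrite -odd_vertex_in_mixed -even_vertex_in_mixed -eqpq
  odd_vertex_in_mixed even_vertex_in_mixed !eqxx.
Qed.

(* Two odd vertices, or two even ones, are never adjacent, so the symmetric
   difference of two adjacent pairs cannot contain both. *)
Lemma mixed_pair_nadj p q : ~~ adj (mixed_pair p) (mixed_pair q).
Proof.
apply/negP => adjpq.
have eq1 : p.1 = q.1.
  apply/eqP/negP => /negP neq.
  have := double_vertex_adj_in_symdiff (u := odd_vertex p.1) (v := odd_vertex q.1) adjpq.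
  rewrite !in_setU !in_setD !odd_vertex_in_mixed odd_vertex_eq !eqxx.
  rewrite (eq_sym q.1) neq => /(_ isT isT isT).
  by rewrite /= /path_adj /=; lia.
have eq2 : p.2 = q.2.
  apply/eqP/negP => /negP neq.
  have := double_vertex_adj_in_symdiff (u := even_vertex p.2) (v := even_vertex q.2) adjpq.
  rewrite !in_setU !in_setD !even_vertex_in_mixed even_vertex_eq !eqxx.
  rewrite (eq_sym q.2) neq => /(_ isT isT isT).
  by rewrite /= /path_adj /=; lia.
by move: adjpq; rewrite (_ : p = q) ?adj_irrefl //; case: p q eq1 eq2 => ? ? [? ?] /= -> ->.
Qed.

End Fan.

Theorem theorem1p1 (m : nat) (hm : 2 <= m) :
  independence_number (double_vertex_graph (fan1 m)) = m ^ 2 %/ 4.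
Proof.
apply/eqP; rewrite eqn_leq; apply/andP; split.
  apply: (independence_number_clique_cover
    (f := fun A : double_vertex_graph (fan1 m) => pair_code (val A))).
    by move=> A; apply: pair_code_bound.
  exact: pair_code_adj.
have <- : #|[set mixed_pair p | p : 'I_m./2 * 'I_(uphalf m)]| = m ^ 2 %/ 4.
  by rewrite (card_imset _ (@mixed_pair_inj m)) card_prod !card_ord sqr_div4.
apply: leq_independence_number; apply/forall_inP => _ /imsetP[p _ ->].
by apply/forall_inP => _ /imsetP[q _ ->]; rewrite mixed_pair_nadj implybT.
Qed.
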